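(* For any graph $G$ without isolated vertices, $$\operatorname{im}(S(G))=|G|-\gamma(G).$$
   Context: Graphs are finite, without loops or multiple edges; $|G|$ is the number of vertices of $G$. The subdivision graph $S(G)$ is obtained from $G$ by subdividing each edge exactly once; equivalently it is the bipartite graph on $V(G)\cup E(G)$ with $x\in V(G)$ adjacent to $e\in E(G)$ if and only if $x\in e$. For a graph $H$, $\operatorname{im}(H)$ is the maximum cardinality of an induced matching of $H$, i.e. of a matching $M$ such that the subgraph induced on the vertices covered by $M$ has no edges other than those of $M$. The domination number $\gamma(G)$ is the minimum size of a dominating set, i.e. of a set $A\subseteq V(G)$ whose closed neighbourhood $N_G[A]$ is all of $V(G)$. *)

(* Defs.v *)
From mathcomp Require Import all_boot.

Set Implicit Arguments.
Unset Strict Implicit.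
Unset Printing Implicit Defensive.

Record sgraph := SGraph {
  vertex :> finType;
  adj : rel vertex;
  adj_sym : symmetric adj;
  adj_irrefl : irreflexive adj }.

Definition isolated (G : sgraph) (x : G) : bool := [forall y : G, ~~ adj x y].

Definition edges (G : sgraph) : {set {set G}} :=
  [set e | [exists x : G, exists y : G, adj x y && (e == [set x; y])]].

Definition edge (G : sgraph) : finType := {e : {set G} | e \in edges G}.

Definition closed_nbhd (G : sgraph) (A : {set G}) : {set G} :=
  A :|: [set y | [exists x in A, adj x y]].

Definition dominating (G : sgraph) (A : {set G}) : bool :=
  closed_nbhd A == [set: G].

Lemma dominatingT (G : sgraph) : dominating [set: G].
Proof. by rewrite /dominating /closed_nbhd setTU. Qed.

(* The default [set: G] of the arg min is itself dominating (dominatingT),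
   so this is the true minimum. *)
Definition domination_number (G : sgraph) : nat :=
  #|[arg min_(A < [set: G] | dominating A) #|A|]|.

(* Hence the truncated difference #|G| - domination_number G is the
   integer difference. *)
Lemma domination_number_leq (G : sgraph) : domination_number G <= #|G|.
Proof. exact: max_card. Qed.

Definition matching (H : sgraph) (M : {set {set H}}) : bool :=
  (M \subset edges H) && trivIset M.

Definition induced_matching (H : sgraph) (M : {set {set H}}) : bool :=
  matching M && [forall e in edges H, (e \subset cover M) ==> (e \in M)].

Definition induced_matching_number (H : sgraph) : nat :=
  \max_(M : {set {set H}} | induced_matching M) #|M|.

Section Subdivision.
Variable G : sgraph.

Definition subdivision_adj : rel (G + edge G) := fun u v =>
  match u, v with
  | inl x, inr e => x \in val e
  | inr e, inl x => x \in val e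
  | _, _ => false
  end.

Lemma subdivision_adj_sym : symmetric subdivision_adj.
Proof. by case=> [x|e] [y|f]. Qed.

Lemma subdivision_adj_irrefl : irreflexive subdivision_adj.
Proof. by case. Qed.

Definition subdivision : sgraph :=
  SGraph subdivision_adj_sym subdivision_adj_irrefl.

End Subdivision.

(* Main.v *)
Require Import Defs.
From mathcomp Require Import all_boot.

Set Implicit Arguments.
Unset Strict Implicit.
Unset Printing Implicit Defensive.

(** An edge of [S(G)] is a pair [{x, e}] of a vertex [x] of [G] and an edge [e]
    of [G] through [x], that is, a choice of a neighbour of [x]: the other end
    of [e].  Induced matchings of [S(G)] correspond in this way to the sets [X]
    of vertices in which every vertex has a chosen neighbour outside [X], and
    these are the complements of dominating sets.

    If [M] is an induced matching and [X] is the set of vertices of [G] that it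
    covers, then [|X| = |M|].  For [{x, e}] in [M] with [e = {x, y}], the vertex
    [y] is not in [X], because otherwise inducedness would put [{y, e}] in [M]
    although it meets [{x, e}] in [e].  So the complement of [X] dominates
    ([induced_matching_dominating]).

    If [A] is dominating, every [x] outside [A] has a neighbour [y] in [A], and
    the pairs [{x, {x, y}}] form a matching of size [|G| - |A|].  It is induced,
    because [x] is the only end of [{x, y}] that it covers
    ([dominating_induced_matching]).

    Maximising [|M|] is therefore the same as minimising [|A|]. *)

(** * Dominating sets and edges of the subdivision graph *)

Lemma domination_number_min (G : sgraph) (A : {set G}) :
  dominating A -> domination_number G <= #|A|.
Proof.
rewrite /domination_number; case: arg_minnP => [|B _ minB]; last exact: minB.
exact: dominatingT.
Qed.

Lemma domination_number_attained (G : sgraph) :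
  exists2 A : {set G}, dominating A & #|A| = domination_number G.
Proof.
rewrite /domination_number; case: arg_minnP => [|A domA _]; last by exists A.
exact: dominatingT.
Qed.

Lemma dominatingP (G : sgraph) (A : {set G}) :
  reflect (forall x, x \notin A -> exists2 y, y \in A & adj y x)
          (dominating A).
Proof.
apply: (iffP eqP) => [NA x xA | domA].
  have := in_setT x; rewrite -NA !inE (negbTE xA) /=.
  by case/existsP=> y /andP[yA yx]; exists y.
apply/setP=> x; rewrite !inE; case: (boolP (x \in A)) => //= /domA[y yA yx].
by apply/existsP; exists y; rewrite yA.
Qed.

Lemma mem_edges (G : sgraph) (x y : G) : adj x y -> [set x; y] \in edges G.
Proof.
by move=> xy; rewrite inE; apply/existsP; exists x; apply/existsP; exists y;
   rewrite xy eqxx.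
Qed.

Lemma edge_other_end (G : sgraph) (e : edge G) (x : G) :
  x \in val e -> exists2 y, y \in val e & adj y x.
Proof.
have := valP e; rewrite inE => /existsP[a /existsP[b /andP[ab /eqP->]]].
rewrite !inE => /orP[]/eqP->.
  by exists b; rewrite ?set22 // adj_sym.
by exists a; rewrite ?set21.
Qed.

Lemma subdivision_edgeP (G : sgraph) (m : {set subdivision G}) :
  reflect (exists (x : G) (e : edge G),
             x \in val e /\ m = [set inl x; inr e] :> {set subdivision G})
          (m \in edges (subdivision G)).
Proof.
apply: (iffP idP) => [|[x [e [xe ->]]]]; last exact: mem_edges.
rewrite inE => /existsP[u /existsP[v /andP[]]].
case: u v => [x|e] [y|f] //= inc /eqP->; first by exists x, f.
by exists y, e; rewrite setUC.
Qed.

(** * From induced matchings to dominating sets *)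

Definition matched_vertices (G : sgraph) (M : {set {set subdivision G}}) :
  {set G} := [set x | (inl x : subdivision G) \in cover M].

(** Each edge of [S(G)] has an end in [V(G)], and disjoint edges have different
    ones. *)
Lemma card_matching_le (G : sgraph) (M : {set {set subdivision G}}) :
  matching M -> #|M| <= #|matched_vertices M|.
Proof.
case/andP=> edgeM trivM.
pose block (x : G) := pblock M (inl x : subdivision G).
apply: leq_trans (leq_imset_card block (matched_vertices M)).
apply/subset_leq_card/subsetP=> m mM.
have /subdivision_edgeP[x [e [_ mE]]] := subsetP edgeM m mM.
have xm : (inl x : subdivision G) \in m by rewrite mE set21.
apply/imsetP; exists x; last by rewrite /block (def_pblock trivM mM xm).
by rewrite inE; apply/bigcupP; exists m.
Qed.

Lemma induced_matching_dominating (G : sgraph) (M : {set {set subdivision G}}) :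
  induced_matching M -> dominating (~: matched_vertices M).
Proof.
case/andP=> /andP[edgeM trivM] /forallP indM.
apply/dominatingP=> x; rewrite inE negbK inE => /bigcupP[m mM xm].
have /subdivision_edgeP[x' [e [xe mE]]] := subsetP edgeM m mM.
move: xm; rewrite mE !inE orbF => /eqP[xx']; subst x'.
have [y ye yx] := edge_other_end xe; exists y => //.
have em : (inr e : subdivision G) \in m by rewrite mE set22.
rewrite !inE; apply/negP=> yM.
pose m' : {set subdivision G} := [set inl y; inr e].
have m'M : m' \in M.
  have /implyP/(_ _)/implyP := indM m'; apply.
    by apply/subdivision_edgeP; exists y, e.
  apply/subsetP=> u; rewrite !inE => /orP[]/eqP-> //.
  by apply/bigcupP; exists m.
have e_m' : (inr e : subdivision G) \in m' by rewrite set22.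
(* Both [m] and [m'] are the block of [inr e], so [y = x] and [G] has a loop. *)
have mm' : m = m'.
  by rewrite -(def_pblock trivM mM em) (def_pblock trivM m'M e_m').
have : (inl y : subdivision G) \in m by rewrite mm' set21.
rewrite mE !inE orbF => /eqP[yxE].
by rewrite yxE adj_irrefl in yx.
Qed.

(** * From dominating sets to induced matchings *)

(** Given by its membership predicate because [[set x; f x]] is an element of
    the type [edge G] only when [x] and [f x] are adjacent; in that case this is
    the edge of [S(G)] from [x] towards [f x] (see [spokeE]). *)
Definition spoke (G : sgraph) (f : G -> G) (x : G) : {set subdivision G} :=
  [set u : G + edge G |
     match u with inl z => z == x | inr e => val e == [set x; f x] end].

Lemma mem_spoke_vertex (G : sgraph) (f : G -> G) (x z : G) :
  ((inl z : subdivision G) \in spoke f x) = (z == x).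
Proof. by rewrite inE. Qed.

Lemma mem_spoke_edge (G : sgraph) (f : G -> G) (x : G) (e : edge G) :
  ((inr e : subdivision G) \in spoke f x) = (val e == [set x; f x]).
Proof. by rewrite inE. Qed.

Lemma spokeE (G : sgraph) (f : G -> G) (x : G) (e : edge G) :
  val e = [set x; f x] -> spoke f x = [set inl x; inr e].
Proof.
move=> eE; apply/setP=> -[z|e'].
  by rewrite mem_spoke_vertex !inE orbF.
by rewrite mem_spoke_edge !inE -eE.
Qed.

Lemma spoke_inj (G : sgraph) (f : G -> G) : injective (spoke f).
Proof.
move=> x y xy; apply/eqP.
by rewrite -(mem_spoke_vertex f y x) -xy mem_spoke_vertex.
Qed.

Lemma spoke_edge (G : sgraph) (f : G -> G) (x : G) :
  adj (f x) x -> spoke f x \in edges (subdivision G).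
Proof.
rewrite adj_sym => /mem_edges xfE.
pose e : edge G := exist (fun e => e \in edges G) _ xfE.
rewrite (@spokeE _ _ _ e) //; apply/subdivision_edgeP.
by exists x, e; rewrite set21.
Qed.

(** Since the far end of each spoke lies in [A], an edge of [G] used by a spoke
    has only one end outside [A]; this gives both disjointness and
    inducedness. *)
Lemma spokes_induced_matching (G : sgraph) (A : {set G}) (f : G -> G) :
  (forall x, x \notin A -> f x \in A /\ adj (f x) x) ->
  induced_matching (spoke f @: ~: A).
Proof.
move=> fP.
have end_outside x y : x \notin A -> y \notin A -> x \in [set y; f y] -> x = y.
  move=> xA yA; rewrite !inE => /orP[/eqP // | /eqP xE].
  by have [] := fP y yA; rewrite -xE (negbTE xA).
apply/andP; split; first (apply/andP; split).
- apply/subsetP=> _ /imsetP[x xA ->]; rewrite inE in xA.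
  by apply: spoke_edge; case: (fP x xA).
- apply/trivIsetP=> _ _ /imsetP[x xA ->] /imsetP[y yA ->] neq.
  rewrite !inE in xA yA.
  rewrite -setI_eq0; apply/eqP/setP=> u; rewrite in_setI in_set0.
  apply/negP=> /andP[ux uy]; case/eqP: neq; congr spoke.
  case: u ux uy => [z|e].
    by rewrite !mem_spoke_vertex => /eqP<- /eqP<-.
  rewrite !mem_spoke_edge => /eqP-> /eqP xy.
  by rewrite (end_outside x y) // -xy set21.
apply/forallP=> m; apply/implyP=> /subdivision_edgeP[z [e [ze mE]]].
apply/implyP=> /subsetP sub.
have /bigcupP[_ /imsetP[x xA ->]] := sub (inl z) ltac:(by rewrite mE set21).
rewrite mem_spoke_vertex => /eqP zx; subst z.
have /bigcupP[_ /imsetP[y yA ->]] := sub (inr e) ltac:(by rewrite mE set22).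
rewrite mem_spoke_edge => /eqP eE; rewrite !inE in xA yA.
have xy : x = y by apply: end_outside; rewrite // -eE.
by subst y; rewrite mE -(spokeE eE) imset_f // inE.
Qed.

Lemma dominating_induced_matching (G : sgraph) (A : {set G}) :
  dominating A ->
  exists2 M : {set {set subdivision G}}, induced_matching M & #|M| = #|~: A|.
Proof.
move/dominatingP=> domA.
pose f (x : G) := odflt x [pick y in A | adj y x].
exists (spoke f @: ~: A); last by apply: card_imset; exact: spoke_inj.
apply: spokes_induced_matching => x /domA[y yA yx].
rewrite /f; case: pickP => [z /andP[] // | /(_ y)].
by rewrite yA yx.
Qed.

(** * The equality *)

Theorem proposition4p5 (G : sgraph) (noisol : forall x : G, ~~ isolated x) :
  induced_matching_number (subdivision G) = #|G| - domination_number G.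
Proof.
apply/eqP; rewrite eqn_leq; apply/andP; split.
  apply/bigmax_leqP=> M indM; have /andP[matM _] := indM.
  have := domination_number_min (induced_matching_dominating indM).
  rewrite leq_subRL ?domination_number_leq // => domle.
  rewrite -(cardsC (matched_vertices M)) addnC.
  exact: leq_add (card_matching_le matM) domle.
have [A domA <-] := domination_number_attained G.
have [M indM cardM] := dominating_induced_matching domA.
rewrite -cardsT -(setIidPr (subsetT A)) -cardsD setTD -cardM.
exact: leq_bigmax_cond.
Qed.
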